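(* Let $H$ be a real Hilbert space, $C\subseteq H$ a nonempty, convex and closed set, and $F:H\to H$ an operator such that the solution set $\Omega$ of $\mathrm{VI}(F,C)$ is nonempty. Assume that $F$ is pseudo-monotone on $H$, Lipschitz continuous with constant $L>0$ and sequentially weak-to-weak continuous, and let $0<\lambda<\frac1L$. Let $(\rho_n)_{n\ge0}\subseteq[1,2)$ with $\limsup_{n\to+\infty}\rho_n<2-\frac{2\lambda L}{1+\lambda L}$. Let $x_0\in H$ and let, for all $n\ge0$, $$y_n=P_C(x_n-\lambda F(x_n)),\qquad x_{n+1}=\rho_n\left(y_n+\lambda(F(x_n)-F(y_n))\right)+(1-\rho_n)x_n,$$ and assume that $x_n\ne y_n$ and $F(y_n)\neq0$ for every $n\ge0$. Then the sequence $(x_n)_{n\ge0}$ converges weakly to a solution of $\mathrm{VI}(F,C)$.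
   Context: $\mathrm{VI}(F,C)$ is the problem of finding $x^*\in C$ such that $\langle F(x^* ),x-x^*\rangle\ge 0$ for all $x\in C$; $\Omega$ denotes its solution set. $P_C$ is the metric projection onto $C$. $F$ is pseudo-monotone on a set $S\subseteq H$ if for all $x,y\in S$: $\langle F(x),y-x\rangle\ge 0\Rightarrow\langle F(y),y-x\rangle\ge0$. $F$ is Lipschitz continuous with constant $L$ if $\|F(x)-F(y)\|\le L\|x-y\|$ for all $x,y\in H$. $F$ is sequentially weak-to-weak continuous if $x_n\rightharpoonup x$ implies $F(x_n)\rightharpoonup F(x)$. The iteration is Tseng's forward-backward-forward algorithm with relaxation parameters $(\rho_n)$; the algorithm stops if $y_n=x_n$ or $F(y_n)=0$, and the assumption that this never occurs means that it generates an infinite sequence. *)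

(* Defs.v *)
From HB Require Import structures.
From mathcomp Require Import all_boot all_order all_algebra.
From mathcomp Require Import all_classical all_reals all_analysis.

Set Implicit Arguments.
Unset Strict Implicit.
Unset Printing Implicit Defensive.

Import Order.TTheory GRing.Theory Num.Theory.
Import numFieldNormedType.Exports.

Local Open Scope classical_set_scope.
Local Open Scope ring_scope.

(* A real Hilbert space is presented as a Banach space [H] over [R : realType]
   together with a positive definite symmetric bilinear form
   [dot : {dot H for idfun}] that induces its norm. *)
Definition norm_induced_by (R : realType) (H : normedModType R)
    (dot : {dot H for idfun}) : Prop :=
  forall x : H, `|x| = Num.sqrt (dot x x).

Section vi.
Variables (R : realType) (H : completeNormedModType R).
Implicit Types (dot : {dot H for idfun}) (C S : set H) (F : H -> H)
  (u : nat -> H) (x : H).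

Definition vi_solutions dot F C : set H :=
  [set xs | C xs /\ forall x, C x -> 0 <= dot (F xs) (x - xs)].

Definition pseudo_monotone_on dot S F : Prop :=
  forall x y, S x -> S y ->
    0 <= dot (F x) (y - x) -> 0 <= dot (F y) (y - x).

(* [get] picks the (unique, when C is nonempty, closed and convex) point of C
   at minimal distance from x. *)
Definition metric_proj C x : H :=
  get [set p | C p /\ forall z, C z -> `|x - p| <= `|x - z|].

Definition weak_cvg u x : Prop :=
  forall phi : {scalar H}, continuous phi -> phi (u n) @[n --> \oo] --> phi x.

Definition seq_weak_weak_continuous F : Prop :=
  forall u x, weak_cvg u x -> weak_cvg (F \o u) (F x).

End vi.

(* Main.v *)
(* Put e = x_n - y_n and k = lambda L.  The obtuse-angle property of the
   projection together with pseudo-monotonicity gives, for every solution p,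
     |x_{n+1} - p|^2 <= |x_n - p|^2 - rho_n (1+k) (2 - rho_n (1+k)) |e|^2,
   and the bound on limsup rho_n keeps the last coefficient eventually above a
   positive constant.  Hence (x_n) is Fejer monotone from some rank on and
   x_n - y_n -> 0; by Opial's argument it remains to see that every weak
   sequential cluster point p solves the problem.  If F p <> 0, then
   <F y_n, q - y_n> is asymptotically nonnegative for q in C along the
   subsequence, so <F y_n, q + t F p - y_n> is eventually nonnegative for every
   t > 0, because <F y_n, F p> -> |F p|^2 > 0.  Pseudo-monotonicity transfers
   this to F (q + t F p), and a Minty argument concludes. *)
Require Import Defs.
From HB Require Import structures.
From mathcomp Require Import all_boot all_order all_algebra.
From mathcomp Require Import all_classical all_reals all_analysis.
From mathcomp Require Import ring lra.

Set Implicit Arguments.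
Unset Strict Implicit.
Unset Printing Implicit Defensive.

Import Order.TTheory GRing.Theory Num.Theory.
Import numFieldNormedType.Exports.

Local Open Scope classical_set_scope.
Local Open Scope ring_scope.

(** * Inner products, metric projection and Riesz representation *)

Section inner_product.
Variables (R : realType) (H : completeNormedModType R) (dot : {dot H for idfun}).
Hypothesis Hilbert : norm_induced_by dot.
Implicit Types (x y z v w : H) (a b : R) (C : set H).

Lemma dotC x y : dot x y = dot y x.
Proof. by rewrite hermC expr0 mul1r. Qed.

Lemma dotDl x y z : dot (x + y) z = dot x z + dot y z.
Proof. exact: linearDl. Qed.
Lemma dotNl x z : dot (- x) z = - dot x z.
Proof. exact: linearNl. Qed.
Lemma dotZl a x z : dot (a *: x) z = a * dot x z.
Proof. exact: linearZl_LR. Qed.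
Lemma dotDr x y z : dot z (x + y) = dot z x + dot z y.
Proof. exact: linearDr. Qed.
Lemma dotNr x z : dot z (- x) = - dot z x.
Proof. exact: linearNr. Qed.
Lemma dotZr a x z : dot z (a *: x) = a * dot z x.
Proof. by rewrite linearZr_LR. Qed.
Definition dotE := (dotDl, dotNl, dotZl, dotDr, dotNr, dotZr).

Lemma dot_ge0 x : 0 <= dot x x.
Proof.
have [->|x0] := eqVneq x 0; first by rewrite linear0l.
exact/ltW/neq0_dnorm_gt0.
Qed.

Lemma dot_le0_eq0 x : dot x x <= 0 -> x = 0.
Proof.
by apply: contra_leP => /eqP; exact: neq0_dnorm_gt0.
Qed.

Lemma sqr_normE x : `|x| ^+ 2 = dot x x.
Proof. by rewrite Hilbert sqr_sqrtr// dot_ge0. Qed.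

Lemma cauchy_schwarz x y : `|dot x y| <= `|x| * `|y|.
Proof.
have [->|y0] := eqVneq y 0; first by rewrite linear0r !normr0 mulr0.
have yy : 0 < dot y y by exact: neq0_dnorm_gt0.
rewrite -(@ler_pXn2r _ 2)// ?nnegrE ?mulr_ge0//.
rewrite exprMn !sqr_normE real_normK ?num_real//.
have := dot_ge0 (dot y y *: x - dot x y *: y).
rewrite !dotE (dotC y x) => h.
suff : 0 <= dot y y * (dot x x * dot y y - dot x y ^+ 2).
  by rewrite pmulr_rge0// subr_ge0.
by apply: le_trans h _; rewrite le_eqVlt; apply/orP; left; apply/eqP; ring.
Qed.

Lemma dot_ge_normM x y : - (`|x| * `|y|) <= dot x y.
Proof. by move: (cauchy_schwarz x y); rewrite ler_norml => /andP[]. Qed.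

Lemma dot_le_normM x y : dot x y <= `|x| * `|y|.
Proof. by move: (cauchy_schwarz x y); rewrite ler_norml => /andP[]. Qed.

(** Plays the role of letting t tend to 0 after a first-order inequality has been divided by t. *)
Lemma le0_of_small a b : (forall t, 0 < t <= 1 -> a <= t * b) -> a <= 0.
Proof.
move=> ab; rewrite leNgt; apply/negP => a0.
have b0 := normr_ge0 b.
have ab0 : 0 < a + `|b| by rewrite ltr_wpDr.
(* This t satisfies t b < a, because b < a + |b|. *)
have /ab : 0 < a / (a + `|b|) <= 1.
  by rewrite divr_gt0//= ler_pdivrMr// mul1r lerDl.
apply/negP; rewrite -ltNge mulrAC ltr_pdivrMr//.
by rewrite ltr_pM2l//; have := ler_norm b; lra.
Qed.

Lemma convex_setD C x y t : convex_set C -> C x -> C y -> 0 <= t -> t <= 1 ->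
  C (t *: x + (1 - t) *: y).
Proof.
move=> Cconv Cx Cy t0 t1.
by have /set_mem := Cconv x y (Itv01 t0 t1) (mem_set Cx) (mem_set Cy).
Qed.

(** A minimizing sequence is Cauchy by the parallelogram identity; completeness and closedness then
    give a limit in C that attains the infimum. *)
Lemma metric_projP C x : C !=set0 -> convex_set C -> closed C ->
  C (metric_proj C x) /\ forall z, C z -> `|x - metric_proj C x| <= `|x - z|.
Proof.
move=> [c0 Cc0] Cconv Ccl; rewrite /metric_proj.
suff [p Cp pmin] : exists2 p, C p & forall z, C z -> `|x - p| <= `|x - z|.
  by apply: (@getPex _ [set q | C q /\ forall z, C z -> `|x - q| <= `|x - z|]);
     exists p.
pose D := [set `|x - z| ^+ 2 | z in C].
have infD : has_inf D.
  split; first by exists (`|x - c0| ^+ 2), c0.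
  by exists 0 => _ [z _ <-]; exact: sqr_ge0.
have D_ge z : C z -> inf D <= `|x - z| ^+ 2.
  by move=> Cz; apply: ge_inf; [exact: infD.2|exists z].
have /choice[z zP] (n : nat) :
    exists z, C z /\ `|x - z| ^+ 2 < inf D + n.+1%:R^-1.
  have n0 : 0 < n.+1%:R^-1 :> R by rewrite invr_gt0.
  by have [_ [z Cz <-] zn] := inf_adherent n0 infD; exists z.
have zz n m : `|z n - z m| ^+ 2 <= 2 * n.+1%:R^-1 + 2 * m.+1%:R^-1.
  have [[Cn zn] [Cm zm]] := (zP n, zP m).
  (* The weight 1/2 gives the midpoint of [z n] and [z m], whose squared distance to x is at least
     [inf D]. *)
  have h0 : 0 <= 2^-1 :> R by rewrite invr_ge0.
  have h1 : 2^-1 <= 1 :> R by lra.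
  have := D_ge _ (convex_setD Cconv Cn Cm h0 h1).
  move: zn zm; rewrite !sqr_normE !dotE (dotC (z n) x) (dotC (z m) x).
  rewrite (dotC (z m) (z n)).
  by move: (n.+1%:R^-1) (m.+1%:R^-1) => a b; lra.
have /cvg_ex[p zp] : cvg (z @ \oo).
  apply/cauchy_cvgP/cauchy_ballP => e e0.
  have e4 : 0 < e ^+ 2 / 4 by rewrite divr_gt0// exprn_gt0.
  near_simpl; near=> n m; rewrite -ball_normE /=.
  rewrite -(@ltr_pXn2r _ 2)// ?nnegrE ?(ltW e0)//.
  apply: le_lt_trans (zz n m) _.
  have : n.+1%:R^-1 < e ^+ 2 / 4.
    by near: n; exact: (near_infty_natSinv_lt (PosNum e4)).
  have : m.+1%:R^-1 < e ^+ 2 / 4.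
    by near: m; exact: (near_infty_natSinv_lt (PosNum e4)).
  by move: (n.+1%:R^-1) (m.+1%:R^-1) => a b; lra.
exists p.
  move: zp; apply: (closed_cvg C) => //.
  by apply: nearW => n; exact: (zP n).1.
move=> w Cw; rewrite -(@ler_pXn2r _ 2)// ?nnegrE// -[leRHS]addr0 -subr_ge0.
have xz : `|x - z n| ^+ 2 @[n --> \oo] --> `|x - p| ^+ 2.
  have h : `|x - z n| @[n --> \oo] --> `|x - p|.
    by apply: cvg_norm; apply: cvgB => //; exact: cvg_cst.
  exact: (cvgM h h).
apply: (cvgr_to_ge (cvgB (cvgD (cvg_cst _) (@cvg_harmonic R)) xz)).
apply: nearW => n /=; rewrite subr_ge0.
by apply: le_trans (ltW (zP n).2) _; rewrite lerD2r D_ge.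
Unshelve. all: by end_near. Qed.

(** The point p + t (z - p) of C is no closer to x than p; expand the square, divide by t and let t
    tend to 0. *)
Lemma metric_proj_obtuse C x z : convex_set C -> closed C -> C z ->
  dot (x - metric_proj C x) (z - metric_proj C x) <= 0.
Proof.
move=> Cconv Ccl Cz.
have [] := @metric_projP C x _ Cconv Ccl; first by exists z.
set p := metric_proj C x => Cp pmin.
suff : 2 * dot (x - p) (z - p) <= 0 by rewrite pmulr_rle0.
apply: (@le0_of_small _ (`|z - p| ^+ 2)) => t /andP[t0 t1].
have := pmin _ (convex_setD Cconv Cz Cp (ltW t0) t1).
rewrite -(@ler_pXn2r _ 2)// ?nnegrE//.
have -> : x - (t *: z + (1 - t) *: p) = (x - p) - t *: (z - p).
  by rewrite scalerBl scale1r addrCA -scalerBr opprD addrA.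
rewrite !sqr_normE; move: (x - p) (z - p) => d e; rewrite !dotE (dotC e d).
by move=> h; rewrite -(ler_pM2l t0); lra.
Qed.

(* The representing vector is a multiple of the projection of 0 onto the
   hyperplane [phi = 1]. *)
Lemma riesz (phi : {scalar H}) :
  continuous phi -> exists p, forall v, phi v = dot p v.
Proof.
move=> phic.
have [phi0|/existsNP[v0 /eqP v0P]] := pselect (forall v, phi v = 0).
  by exists 0 => v; rewrite phi0 linear0l.
pose C := [set v | phi v = 1].
have Cconv : convex_set C.
  move=> x y l /set_mem Cx /set_mem Cy; apply/mem_set; rewrite /C/= /conv/=.
  by rewrite linearD !linearZ/= Cx Cy !mulr1 addrC subrK.
have Ccl : closed C.
  apply: (@preimage_closed _ _ phi [set 1]) => //; exact: closed_eq.
have C1 : C ((phi v0)^-1 *: v0) by rewrite /C/= linearZ/= mulVf.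
have [] := @metric_projP C 0 (ex_intro _ _ C1) Cconv Ccl.
have := @metric_proj_obtuse C 0 _ Cconv Ccl.
set p := metric_proj C 0 => pob Cp _.
have pw w : phi w = 0 -> dot p w = 0.
  move=> w0.
  have Cw b : C (p + b *: w) by rewrite /C/= linearD linearZ/= Cp w0 mulr0 addr0.
  (* Both p + w and p - w lie in C, so the obtuse-angle inequality applies with either sign. *)
  by have := pob _ (Cw 1); have := pob _ (Cw (-1)); rewrite sub0r !dotE; lra.
have pp : dot p p != 0.
  apply/lt0r_neq0/neq0_dnorm_gt0; apply/eqP => p0.
  by move: Cp; rewrite p0 /C/= linear0 => /esym/eqP; rewrite oner_eq0.
exists ((dot p p)^-1 *: p) => v.
have := pw (v - phi v *: p); rewrite linearB linearZ/= Cp mulr1 subrr.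
rewrite !dotE => /(_ erefl)/eqP; rewrite subr_eq0 => /eqP ->.
by rewrite mulrCA mulVf ?mulr1.
Qed.

End inner_product.

(** * Ultrafilter limits and weak sequential compactness of bounded sequences *)

Lemma fmap_ultra (T V : Type) (f : T -> V) (U : set_system T) :
  UltraFilter U -> UltraFilter (f @ U).
Proof.
move=> UU; have PU : ProperFilter U by exact: ultra_proper.
split=> [|G GG UG]; first exact: fmap_proper_filter.
rewrite predeqE => A; split; last exact: UG.
(* Were the preimage of A not in U, its complement would be, and G would contain both A and its
   complement. *)
move=> GA; have [//|UnA] := in_ultra_setVsetC (f @^-1` A) UU.
have /UG GnA : (f @ U) (~` A) by exact: UnA.
by have [t []] := filter_ex (filterI GA GnA).
Qed.

Section weak_convergence.
Variables (R : realType) (H : completeNormedModType R) (dot : {dot H for idfun}).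
Hypothesis Hilbert : norm_induced_by dot.
Implicit Types (x v p : H) (u : nat -> H) (f : nat -> nat) (C Omega : set H).

Lemma bounded_scalar_continuous (phi : {scalar H}) (M : R) :
  (forall v, `|phi v| <= M * `|v|) -> continuous phi.
Proof.
move=> phiM x; apply/cvgrPdist_lt => e e0.
have M1 : 0 < `|M| + 1 by rewrite ltr_wpDl.
near=> z; rewrite -linearB; apply: le_lt_trans (phiM _) _.
have : `|x - z| < e / (`|M| + 1).
  by near: z; apply: cvgr_dist_lt => //; rewrite divr_gt0.
rewrite ltr_pdivlMr// mulrC; apply: le_lt_trans.
by rewrite ler_wpM2r//; have := ler_norm M; lra.
Unshelve. all: by end_near. Qed.

Lemma dot_continuous v : continuous (dot v).
Proof.
apply: (@bounded_scalar_continuous (dot v) `|v|) => w.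
exact: cauchy_schwarz.
Qed.

Lemma weak_cvgP u x :
  weak_cvg u x <-> forall v, dot (u n) v @[n --> \oo] --> dot x v.
Proof.
split=> [ux v|ux phi phic].
  under eq_fun do rewrite dotC.
  rewrite dotC; apply: (ux (dot v)); exact: dot_continuous.
have [p phiE] := riesz Hilbert phic.
under eq_fun do rewrite phiE dotC.
by rewrite phiE dotC; exact: ux.
Qed.

(** Segments are compact, so every bounded real sequence converges along an ultrafilter; the limits
    form a bounded linear functional of v, which Riesz representation turns into x. *)
Lemma ultra_weak_limit u (M : R) (U : set_system nat) : UltraFilter U ->
  (forall n, `|u n| <= M) ->
  exists x, forall v, dot (u n) v @[n --> U] --> dot x v.
Proof.
move=> UU uM.
have PU : ProperFilter U by exact: ultra_proper.
have uMv v n : `|dot (u n) v| <= M * `|v|.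
  by apply: le_trans (cauchy_schwarz Hilbert _ _) _; rewrite ler_wpM2r.
have cv v : cvg (dot (u n) v @[n --> U]).
  have := @segment_compact R (- (M * `|v|)) (M * `|v|).
  rewrite compact_ultra => /(_ (dot (u n) v @[n --> U])).
  case.
  - exact: fmap_ultra.
  - by apply: nearW => n /=; rewrite in_itv/= -ler_norml.
  - by move=> l [_ ?]; apply/cvg_ex; exists l.
pose ell v := lim (dot (u n) v @[n --> U]).
have ellP v : dot (u n) v @[n --> U] --> ell v := cv v.
have ell_lin : scalar ell.
  move=> a v w; apply: cvg_lim => //.
  under eq_fun do rewrite dotDr dotZr.
  exact: (cvgD (cvgM (cvg_cst a) (ellP v)) (ellP w)).
pose ell_mixin := GRing.isLinear.Build R H R *%R ell ell_lin.
pose phi : {scalar H} := HB.pack ell ell_mixin.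
have phiM v : `|phi v| <= M * `|v|.
  apply: (@cvgr_to_le _ U _ _ (fun n => `|dot (u n) v|)).
    exact: (cvg_norm (ellP v)).
  by apply: nearW => n; exact: uMv.
have [x xP] := riesz Hilbert (bounded_scalar_continuous phiM).
by exists x => v; rewrite -xP; exact: ellP.
Qed.

Lemma closed_dot_cvg0 u (M : R) : (forall n, `|u n| <= M) ->
  closed [set v | dot (u n) v @[n --> \oo] --> (0 : R)].
Proof.
move=> uM v clv /=; apply/cvgrPdist_lt => e e0.
have M0 : 0 <= M by apply: le_trans (uM 0%N).
(* Dividing by M + 1 instead of M covers the case M = 0. *)
have M1 : 0 < M + 1 by rewrite ltr_wpDl.
have eM : 0 < e / 2 / (M + 1) by rewrite !divr_gt0.
have [w [/= /cvgrPdist_lt uw]] := clv _ (nbhsx_ballx v _ eM).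
rewrite -ball_normE /= ltr_pdivlMr// => vw.
have e2 : 0 < e / 2 by rewrite divr_gt0.
near=> n.
have : `|0 - dot (u n) w| < e / 2 by near: n; exact: uw.
have -> : v = w + (v - w) by rewrite addrC subrK.
rewrite dotDr !sub0r !normrN => uwn.
apply: le_lt_trans (ler_normD _ _) _.
have := cauchy_schwarz Hilbert (u n) (v - w).
have : `|u n| * `|v - w| <= M * `|v - w| by rewrite ler_wpM2r.
by have := normr_ge0 (v - w); lra.
Unshelve. all: by end_near. Qed.

(* An ultrafilter limit supplies the weak limit x, and the terms u (f k) are
   chosen so that u (f k) - x tends to 0 against every u m.  The vectors W
   against which it tends to 0 form a closed subspace containing all the u m,
   and x is orthogonal to its complement, so no separability of H is needed. *)
Lemma weak_seq_compact u (M : R) : (forall n, `|u n| <= M) ->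
  exists f x, f @ \oo --> \oo /\ weak_cvg (u \o f) x.
Proof.
move=> uM.
have [U [UU Uoo]] := ultraFilterLemma (@eventually_filter).
have PU : ProperFilter U by exact: ultra_proper.
have [x xP] := ultra_weak_limit UU uM.
have /choice[f fP] (k : nat) : exists n, (k <= n)%N /\
    forall m, (m <= k)%N -> `|dot (u n - x) (u m)| < k.+1%:R^-1.
  have k0 : 0 < k.+1%:R^-1 :> R by rewrite invr_gt0.
  suff : U [set n | (k <= n)%N /\
      forall m, (m <= k)%N -> `|dot (u n - x) (u m)| < k.+1%:R^-1].
    by move/filter_ex.
  apply: filterI; first exact/Uoo/nbhs_infty_ge.
  (* Induction on j treats the bounds for m <= j as a finite intersection of members of U. *)
  have : forall j, U [set n | forall m, (m <= j)%N ->
      `|dot (u n - x) (u m)| < k.+1%:R^-1].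
    have h m : \forall n \near U, `|dot (u n - x) (u m)| < k.+1%:R^-1.
      have /cvgrPdist_lt/(_ _ k0) := xP (u m).
      by apply: filterS => n; rewrite distrC dotDl dotNl.
    elim=> [|j IH].
      by apply: filterS (h 0%N) => n ? m; rewrite leqn0 => /eqP ->.
    apply: filterS2 IH (h j.+1) => n IH hj m.
    by rewrite leq_eqVlt => /predU1P[->//|]; exact: IH.
  exact.
exists f, x; split.
  move=> A [N _ NA]; exists N => // k /= Nk; apply: NA => /=.
  exact: leq_trans Nk (fP k).1.
apply/weak_cvgP => v.
pose W := [set w | dot (u (f k) - x) w @[k --> \oo] --> (0 : R)].
suff : W v.
  rewrite /W/=; under eq_fun do rewrite dotDl dotNl.
  by move/subr_cvg0.
have Wcl : closed W.
  apply: (@closed_dot_cvg0 (fun k => u (f k) - x) (M + `|x|)) => k.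
  by apply: le_trans (ler_normB _ _) _; rewrite lerD2r.
have W0 : W !=set0.
  by exists 0; rewrite /W/=; under eq_fun do rewrite linear0r; exact: cvg_cst.
have WD a b v1 v2 : W v1 -> W v2 -> W (a *: v1 + b *: v2).
  move=> w1 w2; rewrite /W/=; under eq_fun do rewrite dotDr !dotZr.
  suff : a * dot (u (f k) - x) v1 + b * dot (u (f k) - x) v2 @[k --> \oo]
      --> a * 0 + b * 0 by rewrite !mulr0 addr0.
  exact: (cvgD (cvgM (cvg_cst a) w1) (cvgM (cvg_cst b) w2)).
have Wconv : convex_set W.
  by move=> v1 v2 l /set_mem w1 /set_mem w2; apply/mem_set; exact: WD.
have Wu m : W (u m).
  apply/cvgrPdist_lt => e e0; near=> k.
  (* As soon as k >= m, the choice of [f k] bounds the product with [u m] by 1/(k+1). *)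
  rewrite sub0r normrN; apply: lt_trans ((fP k).2 m _) _.
    by near: k; exact: nbhs_infty_ge.
  by near: k; exact: (near_infty_natSinv_lt (PosNum e0)).
have [Wp _] := metric_projP Hilbert v W0 Wconv Wcl.
set p := metric_proj W v in Wp.
(* The subspace W contains p + w and p - w, so the obtuse-angle inequality becomes an equality. *)
have ort w : W w -> dot w (v - p) = 0.
  move=> Ww.
  have := @metric_proj_obtuse _ _ _ Hilbert W v (p + w) Wconv Wcl.
  have := @metric_proj_obtuse _ _ _ Hilbert W v (p - w) Wconv Wcl.
  have pK w' : p + w' - p = w' by rewrite addrAC subrr add0r.
  rewrite -/p !pK (dotC dot w).
  have := WD 1 1 _ _ Wp Ww; have := WD 1 (-1) _ _ Wp Ww.
  rewrite !scale1r scaleN1r => h1 h2 /(_ h1) + /(_ h2).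
  by rewrite dotNr; lra.
(* Every [u m] lies in W, hence is orthogonal to v - p; the limit x inherits this. *)
have xort : dot x (v - p) = 0.
  have := xP (v - p); under eq_fun do rewrite ort//.
  by move=> /(cvg_unique _ (cvg_cst _)) ->.
have -> : v = 1 *: p + 1 *: (v - p) by rewrite !scale1r addrC subrK.
apply: WD => //; rewrite /W/=.
under eq_fun do rewrite dotDl dotNl xort ort// subr0.
exact: cvg_cst.
Unshelve. all: by end_near. Qed.

End weak_convergence.

(** * Opial's lemma and quasi-Fejer sequences *)

Section opial.
Variables (R : realType) (H : completeNormedModType R) (dot : {dot H for idfun}).
Hypothesis Hilbert : norm_induced_by dot.
Implicit Types (p q : H) (u : nat -> H) (f g : nat -> nat) (Omega : set H).

Lemma cvgn_sqr_dist_bounded u p :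
  cvgn (fun n => `|u n - p| ^+ 2) -> exists M, forall n, `|u n| <= M.
Proof.
move=> /cvg_seq_bounded/pinfty_ex_gt0[M _ uM].
(* Since 2 t <= 1 + t^2, a bound M on the squared distances bounds the distances by 1 + M. *)
exists (1 + M + `|p|) => n; rewrite -(subrK p (u n)).
apply: le_trans (ler_normD _ _) _; rewrite lerD2r.
have := uM n Logic.I; rewrite /= ger0_norm ?sqr_ge0//.
by have := sqr_ge0 (`|u n - p| - 1); nra.
Qed.

(** The difference of the two squared distances is affine in [dot (u n) (p - q)], which therefore
    converges along the whole sequence; comparing its limits along f and g gives |p - q|^2 = 0. *)
Lemma opial_unique u f g p q : f @ \oo --> \oo -> g @ \oo --> \oo ->
  weak_cvg (u \o f) p -> weak_cvg (u \o g) q ->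
  cvgn (fun n => `|u n - p| ^+ 2) -> cvgn (fun n => `|u n - q| ^+ 2) -> p = q.
Proof.
move=> foo goo /(weak_cvgP Hilbert) ufp /(weak_cvgP Hilbert) ugq up uq.
have [c uc] : exists c : R, dot (u n) (p - q) @[n --> \oo] --> c.
  have E n : dot (u n) (p - q) = 2^-1 *
      (`|u n - q| ^+ 2 - `|u n - p| ^+ 2 + (dot p p - dot q q)).
    by rewrite !(sqr_normE Hilbert) !dotE (dotC dot p) (dotC dot q (u n)); lra.
  eexists; under eq_fun do rewrite E.
  exact: (cvgM (cvg_cst _) (cvgD (cvgB uq up) (cvg_cst _))).
have pc := cvg_unique (@Rhausdorff R) (ufp (p - q)) (cvg_comp _ _ foo uc).
have qc := cvg_unique (@Rhausdorff R) (ugq (p - q)) (cvg_comp _ _ goo uc).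
apply/subr0_eq/(@dot_le0_eq0 _ _ dot).
by rewrite dotDl dotNl pc qc subrr.
Qed.

(** If u did not converge weakly to a cluster point p, a subsequence would stay e away from p
    against some v; by uniqueness its own weak cluster point is again p, a contradiction. *)
Lemma opial u Omega : Omega !=set0 ->
  (forall p, Omega p -> cvgn (fun n => `|u n - p| ^+ 2)) ->
  (forall f p, f @ \oo --> \oo -> weak_cvg (u \o f) p -> Omega p) ->
  exists2 p, Omega p & weak_cvg u p.
Proof.
move=> [p0 Op0] ucvg uOmega.
have [M uM] := cvgn_sqr_dist_bounded (ucvg _ Op0).
have [f [p [foo ufp]]] := weak_seq_compact Hilbert uM.
have Op := uOmega _ _ foo ufp.
exists p => //; apply/(weak_cvgP Hilbert) => v; apply/cvgrPdist_lt => e e0.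
have [[N uN]|h] := pselect (exists N, forall n, (N <= n)%N ->
    `|dot p v - dot (u n) v| < e); first by exists N.
have /choice[g gP] (k : nat) : exists n, (k <= n)%N /\
    e <= `|dot p v - dot (u n) v|.
  apply: contrapT => hk; apply: h; exists k => n kn; rewrite ltNge.
  by apply/negP => en; apply: hk; exists n.
have [f' [q [f'oo ugq]]] := weak_seq_compact Hilbert (fun n => uM (g n)).
have goo : (g \o f') @ \oo --> \oo.
  apply: cvg_comp f'oo _ => A [N _ NA]; exists N => // k /= Nk; apply: NA => /=.
  exact: leq_trans Nk (gP k).1.
have Oq := uOmega (g \o f') _ goo ugq.
have pq := opial_unique foo goo ufp ugq (ucvg _ Op) (ucvg _ Oq).
move: ugq => /(weak_cvgP Hilbert)/(_ v)/cvgrPdist_lt/(_ _ e0)/filter_ex[k /=].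
by rewrite -pq ltNge (gP _).2.
Qed.

End opial.

(** From rank N on, a is nonincreasing and bounded below, hence convergent, and b is squeezed
    between 0 and (a n - a n.+1) / c. *)
Lemma quasi_fejer_cvg (R : realType) (a b : nat -> R) (c : R) (N : nat) :
  0 < c -> (forall n, 0 <= a n) -> (forall n, 0 <= b n) ->
  (forall n, (N <= n)%N -> a n.+1 + c * b n <= a n) ->
  cvgn a /\ b @ \oo --> 0.
Proof.
move=> c0 a0 b0 ab.
have /cvg_ex[l al] : cvgn a.
  suff /cvg_ex[l al] : cvgn (fun n => a (n + N)%N).
    by apply/cvg_ex; exists l; rewrite -(cvg_shiftn N).
  apply: nonincreasing_is_cvgn; last by exists 0 => _ [n _ <-].
  apply/nonincreasing_seqP => n; rewrite addSn.
  apply: le_trans (ab _ (leq_addl _ _)); rewrite lerDl.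
  by rewrite mulr_ge0// ltW.
split; first by apply/cvg_ex; exists l.
have a1 : a n.+1 @[n --> \oo] --> l by rewrite cvg_shiftS.
have h : (a n - a n.+1) / c @[n --> \oo] --> (l - l) / c.
  exact: (cvgM (cvgB al a1) (cvg_cst _)).
rewrite subrr mul0r in h.
apply: (squeeze_cvgr _ (cvg_cst 0) h).
near=> n; rewrite b0/= ler_pdivlMr// mulrC lerBrDl.
by apply: ab; near: n; exact: nbhs_infty_ge.
Unshelve. all: by end_near. Qed.

(** * Descent inequality and weak cluster points of Tseng's iteration *)

Section tseng.
Variables (R : realType) (H : completeNormedModType R) (dot : {dot H for idfun}).
Hypothesis Hilbert : norm_induced_by dot.
Variables (C : set H) (F : H -> H) (L lambda : R).
Hypotheses (C_convex : convex_set C) (C_closed : closed C).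
Hypothesis F_pseudo_monotone : pseudo_monotone_on dot setT F.
Hypothesis F_lip : forall u v, `|F u - F v| <= L * `|u - v|.
Hypotheses (L_gt0 : 0 < L) (lambda_gt0 : 0 < lambda).

Lemma tseng_fejer (p x y : H) (r : R) : vi_solutions dot F C p ->
  C y -> y = metric_proj C (x - lambda *: F x) -> 1 <= r ->
  `|r *: (y + lambda *: (F x - F y)) + (1 - r) *: x - p| ^+ 2 +
    r * (1 + lambda * L) * (2 - r * (1 + lambda * L)) * `|x - y| ^+ 2
  <= `|x - p| ^+ 2.
Proof.
move=> [Cp pP] Cy yE r1.
have proj := metric_proj_obtuse Hilbert (x - lambda *: F x) C_convex C_closed Cp.
rewrite -yE in proj.
have mono : 0 <= dot (F y) (y - p) by apply: F_pseudo_monotone => //; exact: pP.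
have Fxy := F_lip x y.
(* With e = x - y, g = lambda (F x - F y) and b = y - p, the new error is e + b - r (e - g). *)
have -> : r *: (y + lambda *: (F x - F y)) + (1 - r) *: x - p =
    (x - y) + (y - p) - r *: ((x - y) - lambda *: (F x - F y)).
  rewrite addrA subrK -[x - y - _]addrA -opprD; move: (y + _) => h.
  by rewrite scalerBr opprB scalerBl scale1r addrCA addrAC.
have -> : x - p = (x - y) + (y - p) by rewrite addrA subrK.
(* This adds the obtuse-angle inequality and lambda times the pseudo-monotonicity inequality. *)
have db : 0 <= dot ((x - y) - lambda *: (F x - F y)) (y - p).
  have : dot (x - lambda *: F x - y) (p - y) +
      dot (x - lambda *: F x - y) (y - p) = 0.
    by rewrite -dotDr addrA subrK subrr linear0r.
  move: mono proj => /(mulr_ge0 (ltW lambda_gt0)).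
  by rewrite scalerBr !dotDl !dotNl !dotDl !dotNl !dotZl; lra.
have ge : - (lambda * L * `|x - y| ^+ 2) <= dot (lambda *: (F x - F y)) (x - y).
  rewrite dotZl -mulrA -mulrN ler_pM2l//.
  apply: le_trans (dot_ge_normM Hilbert _ _); rewrite lerN2.
  by rewrite expr2 mulrA ler_wpM2r.
have gg : dot (lambda *: (F x - F y)) (lambda *: (F x - F y)) <=
    (lambda * L) ^+ 2 * `|x - y| ^+ 2.
  rewrite -(sqr_normE Hilbert) -exprMn.
  rewrite lerXn2r ?nnegrE ?mulr_ge0 ?(ltW L_gt0) ?(ltW lambda_gt0)//.
  by rewrite -mulrA normrZ gtr0_norm// ler_pM2l.
move: db ge gg; rewrite !(sqr_normE Hilbert).
move: (x - y) (lambda *: (F x - F y)) (y - p) (lambda * L) => e g b k.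
rewrite !dotE (dotC dot g e) (dotC dot b e) (dotC dot g b).
move: (dot e e) (dot e g) (dot g g) (dot b b) (dot e b) (dot b g).
move=> ee eg gg bb eb bg h1 h2 h3.
(* In the expanded square, once [h1] is applied, <e, g> has coefficient -2 r (r - 1); since r >= 1,
   the lower bound on <e, g> is the one to use. *)
have r0 : 0 <= r by lra.
have r10 : 0 <= r - 1 by lra.
have {}h1 := mulr_ge0 r0 h1.
have {}h3 : r * r * gg <= r * r * (k ^+ 2 * ee) by rewrite ler_wpM2l// mulr_ge0.
have {}h2 := ler_wpM2l r0 (ler_wpM2l r10 h2).
lra.
Qed.

Lemma weak_cluster_solution (x y : nat -> H) (f : nat -> nat) (p : H) (M : R) :
  seq_weak_weak_continuous F ->
  (forall n, C (y n)) ->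
  (forall n, y n = metric_proj C (x n - lambda *: F (x n))) ->
  (forall n, `|x n| <= M) -> `|x n - y n| @[n --> \oo] --> 0 ->
  f @ \oo --> \oo -> weak_cvg (x \o f) p -> vi_solutions dot F C p.
Proof.
move=> F_weak Cy yE xM xy0 foo xfp.
have yfp : weak_cvg (y \o f) p.
  apply/(weak_cvgP Hilbert) => v; move: xfp => /(weak_cvgP Hilbert)/(_ v) xfp.
  have e0 : dot (x (f n) - y (f n)) v @[n --> \oo] --> 0.
    have h : `|x n - y n| * `|v| @[n --> \oo] --> 0 * `|v|.
      exact: (cvgM xy0 (cvg_cst _)).
    rewrite mul0r in h.
    apply: (@cvg_comp _ _ _ f (fun n => dot (x n - y n) v) _ _ _ foo).
    apply/norm_cvg0P; apply: (squeeze_cvgr _ (cvg_cst 0) h).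
    by apply: nearW => n; rewrite normr_ge0/= cauchy_schwarz.
  suff : dot (x (f n)) v - dot (x (f n) - y (f n)) v @[n --> \oo] --> dot p v - 0.
    rewrite subr0; under eq_fun do
      rewrite dotDl dotNl opprD opprK addrA subrr add0r.
    exact.
  exact: (cvgB xfp e0).
have Cne : C !=set0 by exists (y 0%N).
have Cp : C p.
  (* C is weakly closed: test the obtuse-angle inequality at the projection of p with the points
     [y (f n)] and pass to the limit. *)
  suff -> : p = metric_proj C p.
    exact: (metric_projP Hilbert p Cne C_convex C_closed).1.
  move: yfp => /(weak_cvgP Hilbert)/(_ (p - metric_proj C p)) h.
  set q := metric_proj C p in h *.
  apply/subr0_eq/(@dot_le0_eq0 _ _ dot); rewrite [leLHS]dotDl dotNl subr_le0.
  apply: (cvgr_to_le h); apply: nearW => n /=.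
  rewrite -subr_le0 -dotNl -dotDl dotC.
  exact: metric_proj_obtuse.
split=> // z Cz.
have [->|/eqP Fp0] := eqVneq (F p) 0; first by rewrite linear0l.
have Fpp : 0 < dot (F p) (F p) by apply: neq0_dnorm_gt0; exact/eqP.
have yM : \forall n \near \oo, `|y n| <= M + 1.
  have : \forall n \near \oo, `|x n - y n| < 1 by exact: (cvgr_lt _ xy0).
  apply: filterS => n xyn.
  have -> : y n = x n - (x n - y n) by rewrite opprB addrC subrK.
  by apply: le_trans (ler_normB _ _) _; rewrite lerD// ltW.
(* The projection inequality bounds lambda <F (y n), q - y n> below by -|x n - y n| K (1 + lambda
   L), where K eventually bounds |q - y n|. *)
have low q e : C q -> 0 < e ->
    \forall n \near \oo, - e <= dot (F (y n)) (q - y n).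
  move=> Cq e0.
  pose K := `|q| + (M + 1).
  have : `|x n - y n| * (K * (1 + lambda * L)) @[n --> \oo] -->
      0 * (K * (1 + lambda * L)).
    exact: (cvgM xy0 (cvg_cst _)).
  rewrite mul0r => /cvgr_lt/(_ _ (mulr_gt0 lambda_gt0 e0)) he.
  near=> n.
  have qK : `|q - y n| <= K.
    apply: le_trans (ler_normB _ _) _; rewrite lerD2l.
    by near: n.
  have eK : `|x n - y n| * (K * (1 + lambda * L)) < lambda * e.
      by near: n; exact: he.
  rewrite -(ler_pM2l lambda_gt0).
  have := metric_proj_obtuse Hilbert (x n - lambda *: F (x n))
    C_convex C_closed Cq.
  rewrite -yE; move: (F_lip (x n) (y n)).
  have -> : x n - lambda *: F (x n) - y n =
      (x n - y n) - lambda *: (F (x n) - F (y n)) - lambda *: F (y n).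
    rewrite scalerBr opprB -[RHS]addrA [_ - _ - lambda *: F (y n)]addrAC.
    by rewrite subrr add0r addrAC.
  move: eK qK.
  move: (F (y n)) (x n - y n) (q - y n) (F (x n) - F (y n)) => h u v g eK vK gL.
  have := dot_ge_normM Hilbert u v.
  have uv : `|u| * `|v| <= `|u| * K by rewrite ler_wpM2l.
  have gv : dot g v <= L * (`|u| * K).
    apply: le_trans (dot_le_normM Hilbert _ _) _.
    apply: (@le_trans _ _ (L * `|u| * `|v|)); first by rewrite ler_wpM2r.
    by rewrite -mulrA ler_wpM2l// ltW.
  have := ler_wpM2l (ltW lambda_gt0) gv.
  by rewrite !dotE; lra.
(* Take q = s z + (1 - s) p in C and t = s r: then p + s w = q + t F p. This point may leave C, so
   pseudo-monotonicity is applied on all of H. *)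
have key r s : 0 < r -> 0 < s <= 1 ->
    0 <= dot (F (p + s *: (z - p + r *: F p))) (z - p + r *: F p).
  move=> r0 /andP[s0 s1]; set w := z - p + r *: F p.
  have wE : p + s *: w = (s *: z + (1 - s) *: p) + (s * r) *: F p.
    by rewrite /w scalerDr scalerA addrA scalerBr scalerBl scale1r addrCA.
  have vE : s *: w = (p + s *: w) - p by rewrite addrAC subrr add0r.
  rewrite -(pmulr_rge0 _ s0) -dotZr; move: (p + s *: w) wE vE => v wE ->.
  have Cq := convex_setD C_convex Cz Cp (ltW s0) s1.
  have sr0 : 0 < s * r by rewrite mulr_gt0.
  (* The error allowed in [low] is half of t |F p|^2, which t <F (y (f n)), F p> eventually
     exceeds. *)
  have e0 : 0 < s * r * (dot (F p) (F p) / 2) by rewrite !mulr_gt0 ?invr_gt0.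
  have lowq := low _ _ Cq e0.
  have := F_weak _ _ yfp => /(weak_cvgP Hilbert)/(_ (F p)) Fyp.
  have Fypos : \forall n \near \oo, dot (F p) (F p) / 2 < dot (F (y (f n))) (F p).
    by apply: (cvgr_gt _ Fyp); lra.
  move: yfp => /(weak_cvgP Hilbert)/(_ (F v)) yfw.
  rewrite dotC dotDl dotNl subr_ge0.
  apply: (cvgr_to_le yfw); near=> n => /=.
  rewrite -subr_ge0 -dotNl -dotDl dotC.
  apply: F_pseudo_monotone => //.
  rewrite wE addrAC dotDr dotZr.
  have : - (s * r * (dot (F p) (F p) / 2)) <=
      dot (F (y (f n))) (s *: z + (1 - s) *: p - y (f n)).
    by near: n; exact: (foo _ lowq).
  have : dot (F p) (F p) / 2 < dot (F (y (f n))) (F p) by near: n.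
  rewrite -(ltr_pM2l sr0).
  by move: (dot (F (y (f n))) (s *: z + (1 - s) *: p - y (f n))) => ?; lra.
(* Letting r tend to 0 removes the perturbation r F p of the direction z - p. *)
rewrite -oppr_le0; apply: (@le0_of_small _ _ (dot (F p) (F p))) => r /andP[r0 _].
rewrite lerNl -subr_ge0 opprK -dotZr -dotDr -oppr_le0.
set w := z - p + _.
(* For fixed r, s tends to 0: by Lipschitz continuity, replacing F (p + s w) by F p costs at most s
   L |w|^2. *)
apply: (@le0_of_small _ _ (L * `|w| ^+ 2)) => s s01.
have := key r s r0 s01; rewrite -/w.
have := dot_le_normM Hilbert (F (p + s *: w) - F p) w.
have : `|F (p + s *: w) - F p| * `|w| <= L * `|s *: w| * `|w|.
  rewrite ler_wpM2r//; apply: le_trans (F_lip _ _) _.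
  by rewrite addrAC subrr add0r.
move: s01 => /andP[s0 _]; rewrite normrZ gtr0_norm// dotDl dotNl; lra.
Unshelve. all: by end_near. Qed.

End tseng.

(** * Control of the relaxation parameters and conclusion *)

Lemma limn_sup_lt_near (R : realType) (u : nat -> R) (l : R) :
  bounded_fun u -> limn_sup u < l -> \forall n \near \oo, u n < l.
Proof.
move=> ub; have uu := bounded_fun_has_ubound ub.
have := cvg_sups_inf uu (bounded_fun_has_lbound ub); rewrite -limn_supE// => su.
(* The tail suprema converge to the limsup, so one of them is below l and dominates its whole
   tail. *)
move=> /(cvgr_lt _ su) -[N _ /(_ N (leqnn N))/= supsN].
exists N => // n /= Nn; apply: le_lt_trans supsN.
by apply: ub_le_sup; [exact: has_ubound_sdrop|exists n].
Qed.

Theorem theorem3p3 (R : realType) (H : completeNormedModType R)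
    (dot : {dot H for idfun}) (Hilbert : norm_induced_by dot)
    (C : set H) (C_nonempty : C !=set0) (C_convex : convex_set C)
    (C_closed : closed C)
    (F : H -> H) (Omega_nonempty : vi_solutions dot F C !=set0)
    (F_pseudo_monotone : pseudo_monotone_on dot setT F)
    (L : R) (L_gt0 : 0 < L) (F_lipschitz : L.-lipschitz F)
    (F_weak_continuous : seq_weak_weak_continuous F)
    (lambda : R) (lambda_gt0 : 0 < lambda) (lambda_lt : lambda < 1 / L)
    (rho : nat -> R) (rho_bounds : forall n, 1 <= rho n < 2)
    (limsup_rho : limn_sup rho < 2 - 2 * lambda * L / (1 + lambda * L))
    (x y : nat -> H)
    (y_def : forall n, y n = metric_proj C (x n - lambda *: F (x n)))
    (x_def : forall n, x n.+1 =
      rho n *: (y n + lambda *: (F (x n) - F (y n))) + (1 - rho n) *: x n)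
    (x_neq_y : forall n, x n <> y n) (Fy_neq0 : forall n, F (y n) <> 0) :
  exists2 xs, vi_solutions dot F C xs & weak_cvg x xs.
Proof.
have F_lip u v : `|F u - F v| <= L * `|u - v| by exact: (F_lipschitz (u, v)).
have Cy n : C (y n).
  rewrite y_def.
  exact: (metric_projP Hilbert _ C_nonempty C_convex C_closed).1.
have k0 : 0 < lambda * L by rewrite mulr_gt0.
have [r [rl r_lt]] : exists r, limn_sup rho < r /\ r * (1 + lambda * L) < 2.
  (* The assumed bound on the limsup equals 2 / (1 + lambda L); r is the midpoint between the limsup
     and that bound. *)
  exists ((limn_sup rho + 2 / (1 + lambda * L)) / 2).
  have : 2 - 2 * lambda * L / (1 + lambda * L) = 2 / (1 + lambda * L).
    by field; rewrite lt0r_neq0// addr_gt0.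
  move: limsup_rho => /[swap] ->; split; first lra.
  by rewrite -ltr_pdivlMr ?addr_gt0//; lra.
have rho_bounded : bounded_fun rho.
  exists 2; split=> [|M M2 n _ /=]; first exact: num_real.
  by have /andP[? ?] := rho_bounds n; rewrite ger0_norm; lra.
have [N _ rhoN] := limn_sup_lt_near rho_bounded rl.
pose c := 2 - r * (1 + lambda * L).
have c0 : 0 < c by rewrite subr_gt0.
have fejer p : vi_solutions dot F C p -> forall n, (N <= n)%N ->
    `|x n.+1 - p| ^+ 2 + c * `|x n - y n| ^+ 2 <= `|x n - p| ^+ 2.
  move=> Op n Nn; have /andP[r1 _] := rho_bounds n.
  apply: le_trans (tseng_fejer Hilbert C_convex C_closed F_pseudo_monotone
    F_lip L_gt0 lambda_gt0 Op (Cy n) (y_def n) r1).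
  rewrite x_def lerD2l ler_wpM2r ?sqr_ge0//.
  have rk : rho n * (1 + lambda * L) <= r * (1 + lambda * L).
    by rewrite ler_wpM2r ?addr_ge0 ?ltW//; exact: rhoN.
  have cn : c <= 2 - rho n * (1 + lambda * L) by rewrite lerD2l lerN2.
  (* The factor rho_n (1 + lambda L) is at least 1, so dropping it from the coefficient leaves the
     uniform lower bound c. *)
  have rk1 : 1 <= rho n * (1 + lambda * L) by rewrite mulr_ege1// lerDl ltW.
  by rewrite (le_trans cn)// ler_peMl// (le_trans (ltW c0)).
have cvg_dist p : vi_solutions dot F C p ->
    cvgn (fun n => `|x n - p| ^+ 2) /\ `|x n - y n| ^+ 2 @[n --> \oo] --> 0.
  move=> Op; apply: (quasi_fejer_cvg c0 _ _ (fejer p Op)) => n; exact: sqr_ge0.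
have [p0 Op0] := Omega_nonempty.
have xy0 : `|x n - y n| @[n --> \oo] --> 0.
  apply/cvgrPdist_lt => e e0.
  have /cvgrPdist_lt/(_ (e ^+ 2)) := (cvg_dist _ Op0).2.
  rewrite exprn_gt0// => /(_ isT); apply: filterS => n.
  by rewrite !sub0r !normrN normrX !normr_id ltr_pXn2r ?nnegrE ?(ltW e0)//.
apply: (opial Hilbert Omega_nonempty) => [p /cvg_dist[]//|f p foo xfp].
have [M xM] := cvgn_sqr_dist_bounded (cvg_dist _ Op0).1.
exact: (weak_cluster_solution Hilbert C_convex C_closed F_pseudo_monotone F_lip
  L_gt0 lambda_gt0 F_weak_continuous Cy y_def xM xy0 foo xfp).
Qed.
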